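(* Let $\{X_i: i\in I\}$ be a finite family of Banach spaces and $\kappa$ a cardinal. (1) $\big(\bigoplus_{i\in I}X_i\big)_{\ell_\infty}$ has the $\kappa$-Daugavet property if and only if $X_i$ has the $\kappa$-Daugavet property for every $i\in I$. (2) $\big(\bigoplus_{i\in I}X_i\big)_{\ell_\infty}$ has the $\kappa$-perfect Daugavet property if and only if $X_i$ has the $\kappa$-perfect Daugavet property for every $i\in I$. In other words, $\mathfrak{Dau}\big(\big(\bigoplus_{i\in I}X_i\big)_{\ell_\infty}\big)=\min_{i\in I}\mathfrak{Dau}(X_i)$ and $\mathfrak{pDau}\big(\big(\bigoplus_{i\in I}X_i\big)_{\ell_\infty}\big)=\min_{i\in I}\mathfrak{pDau}(X_i)$.
   Context: All Banach spaces are real; $\big(\bigoplus_{i\in I}X_i\big)_{\ell_\infty}$ denotes the $\ell_\infty$-sum. $B_X$ and $S_X$ denote the closed unit ball and unit sphere of a Banach space $X$. A slice of $B_X$ is a nonempty intersection of $B_X$ with an open half-space, i.e. a set $\{x\in B_X: f(x)>\sup f(B_X)-\alpha\}$ with $f\in X^*$, $\alpha>0$. For a cardinal $\kappa$ (finite or infinite), $\{y_\alpha:\alpha<\kappa\}$ denotes a set of cardinality at most $\kappa$. $X$ has the $\kappa$-Daugavet property if for every family $\{y_\alpha:\alpha<\kappa\}\subseteq S_X$, every slice $S$ of $B_X$ and every $\varepsilon>0$ there is $x\in S$ with $\|y_\alpha+x\|>2-\varepsilon$ for all $\alpha<\kappa$. $X$ has the $\kappa$-perfect Daugavet property if for every family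 $\{y_\alpha:\alpha<\kappa\}\subseteq S_X$ and every slice $S$ of $B_X$ there is $x\in S$ with $\|y_\alpha+x\|=2$ for all $\alpha<\kappa$. For nonzero $X$, $\mathfrak{Dau}(X)$ (resp. $\mathfrak{pDau}(X)$) is the least cardinal $\kappa$ such that $X$ fails the $\kappa$-Daugavet (resp. $\kappa$-perfect Daugavet) property. *)

(* Defs.v *)
From HB Require Import structures.
From mathcomp Require Import all_boot all_order all_algebra.
From mathcomp Require Import boolp classical_sets functions cardinality reals.
From mathcomp Require Import topology normedtype.

Set Implicit Arguments.
Unset Strict Implicit.
Unset Printing Implicit Defensive.

Import Order.TTheory GRing.Theory Num.Theory.
Import numFieldNormedType.Exports.

Local Open Scope classical_set_scope.
Local Open Scope card_scope.
Local Open Scope ring_scope.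

(** * The l_infty-sum of a finite family of Banach spaces

  As [I] is finite, every element of the product is a bounded family and the
  supremum of the norms of the coordinates is a maximum (it is 0 if [I] is
  empty).  The name [linf_sum] keeps the norm topology apart from the product
  topology of [forall i, X i]. *)

Definition linf_sum (R : realType) (I : finType)
  (X : I -> completeNormedModType R) : Type := forall i, X i.

Section linf_sum.
Context (R : realType) (I : finType) (X : I -> completeNormedModType R).
Local Notation E := (linf_sum X).
Implicit Types x y z : E.

HB.instance Definition _ := Choice.copy E (forall i, X i).

Definition linf_zero : E := fun=> 0.
Definition linf_opp x : E := fun i => - x i.
Definition linf_add x y : E := fun i => x i + y i.
Definition linf_scale (a : R) x : E := fun i => a *: x i.
Definition linf_norm x : R := \big[Num.max/0]_(i : I) `|x i|.

Local Ltac pointwise := apply: functional_extensionality_dep => i.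

Fact linf_addA : associative linf_add.
Proof. by move=> x y z; pointwise; exact: addrA. Qed.
Fact linf_addC : commutative linf_add.
Proof. by move=> x y; pointwise; exact: addrC. Qed.
Fact linf_add0 : left_id linf_zero linf_add.
Proof. by move=> x; pointwise; exact: add0r. Qed.
Fact linf_addN : left_inverse linf_zero linf_opp linf_add.
Proof. by move=> x; pointwise; exact: addNr. Qed.

HB.instance Definition _ :=
  GRing.isZmodule.Build E linf_addA linf_addC linf_add0 linf_addN.

Fact linf_scaleA a b x : linf_scale a (linf_scale b x) = linf_scale (a * b) x.
Proof. by pointwise; exact: scalerA. Qed.
Fact linf_scale1 : left_id 1 linf_scale.
Proof. by move=> x; pointwise; exact: scale1r. Qed.
Fact linf_scaleDr : right_distributive linf_scale +%R.
Proof. by move=> a x y; pointwise; exact: scalerDr. Qed.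
Fact linf_scaleDl x : {morph linf_scale^~ x : a b / a + b}.
Proof. by move=> a b; pointwise; exact: scalerDl. Qed.

HB.instance Definition _ := GRing.Zmodule_isLmodule.Build R E
  linf_scaleA linf_scale1 linf_scaleDr linf_scaleDl.

Lemma linf_norm_coord x i : `|x i| <= linf_norm x.
Proof. exact: (le_bigmax_cond _ (fun i => `|x i|)). Qed.

Lemma linf_norm_le x (r : R) :
  0 <= r -> (forall i, `|x i| <= r) -> linf_norm x <= r.
Proof. by move=> r0 xr; apply: bigmax_le. Qed.

Lemma linf_norm_ge0 x : 0 <= linf_norm x.
Proof. exact: bigmax_ge_id. Qed.

Fact linf_normD x y : linf_norm (x + y) <= linf_norm x + linf_norm y.
Proof.
apply: linf_norm_le => [|i]; first by rewrite addr_ge0 ?linf_norm_ge0.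
by rewrite (le_trans (ler_normD (x i) (y i)))// lerD ?linf_norm_coord.
Qed.

Fact linf_normZ (a : R) x : linf_norm (a *: x) = `|a| * linf_norm x.
Proof.
apply/le_anti/andP; split.
  apply: linf_norm_le => [|i]; first by rewrite mulr_ge0 ?linf_norm_ge0.
  by rewrite [(a *: x) i]/(a *: x i) normrZ ler_wpM2l ?linf_norm_coord.
have [->|a0] := eqVneq a 0; first by rewrite normr0 mul0r linf_norm_ge0.
rewrite mulrC -ler_pdivlMr ?normr_gt0//; apply: linf_norm_le => [|i].
  by rewrite divr_ge0 ?linf_norm_ge0.
rewrite ler_pdivlMr ?normr_gt0// mulrC -normrZ.
exact: (linf_norm_coord (a *: x)).
Qed.

Fact linf_norm_eq0 x : linf_norm x = 0 -> x = 0.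
Proof.
move=> x0; pointwise; apply/eqP; rewrite -normr_le0 -x0.
exact: linf_norm_coord.
Qed.

HB.instance Definition _ :=
  Lmodule_isNormed.Build R E linf_normD linf_normZ linf_norm_eq0.

Lemma linf_normE x : `|x| = \big[Num.max/0]_(i : I) `|x i|.
Proof. by []. Qed.

Fact linf_complete (F : set_system E) : ProperFilter F -> cauchy F -> cvg F.
Proof.
move=> FF Fc.
have Fi i : cvg ((fun x : E => x i) @ F).
  apply: cauchy_cvg; apply/cauchy_ballP => e e0.
  have /cauchy_ballP/(_ e e0) := Fc.
  case=> -[A B] /= [FA FB] AB.
  exists ((fun x : E => x i) @` A, (fun x : E => x i) @` B).
    by split; [apply: filterS FA | apply: filterS FB] => z ?; exists z.
  move=> [_ _] [/= [a Aa <-] [b Bb <-]].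
  have := AB (a, b) (conj Aa Bb); rewrite /= -!ball_normE /= => abe.
  exact: le_lt_trans (linf_norm_coord (a - b) i) abe.
pose l : E := fun i => lim ((fun x : E => x i) @ F).
apply/cvg_ex; exists l; apply/cvgrPdist_le => e e0.
have : \forall x \near F, forall i, `|l i - x i| <= e.
  apply: filter_forall => i.
  by have /cvgrPdist_le/(_ _ e0) := Fi i.
apply: filterS => /= x lx.
exact: (@linf_norm_le (l - (x : E)) e (ltW e0) lx).
Qed.

HB.instance Definition _ := Uniform_isComplete.Build E linf_complete.

End linf_sum.

(** * The kappa-Daugavet properties

  A cardinal is represented by a type [kappa], compared with [#<=] and [#=];
  a family [{y_alpha : alpha < kappa}] is then a set [Y] with
  [Y #<= [set: kappa]]. *)

Section daugavet.
Context (R : realType).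
Implicit Types (X : completeNormedModType R) (kappa : Type).

Definition unit_ball X : set X := [set x | `|x| <= 1].

Definition unit_sphere X : set X := [set x | `|x| = 1].

Definition is_slice X (S : set X) : Prop :=
  exists (f : {linear X -> R^o}) (a : R), [/\ continuous f, 0 < a &
    S = [set x | unit_ball x /\ sup (f @` @unit_ball X) - a < f x]].

Definition daugavet kappa X : Prop :=
  forall Y : set X, Y `<=` @unit_sphere X -> Y #<= [set: kappa] ->
  forall (S : set X) (eps : R), is_slice S -> 0 < eps ->
  exists2 x, S x & forall y, Y y -> 2 - eps < `|y + x|.

Definition perfect_daugavet kappa X : Prop :=
  forall Y : set X, Y `<=` @unit_sphere X -> Y #<= [set: kappa] ->
  forall S : set X, is_slice S ->
  exists2 x, S x & forall y, Y y -> `|y + x| = 2.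

End daugavet.

(** * Least cardinals *)

Definition is_least_cardinal (P : Type -> Prop) (kappa : Type) : Prop :=
  P kappa /\ forall lambda : Type, P lambda -> [set: kappa] #<= [set: lambda].

(* The value is a representative of the cardinal, so it is only meaningful up
   to [#=]; it is junk if no type satisfies [P]. *)
Definition least_cardinal (P : Type -> Prop) : Type :=
  if pselect (exists kappa, is_least_cardinal P kappa) is left ex
  then projT1 (cid ex) else void.

Definition nonzero_space (R : realType) (X : completeNormedModType R) : Prop :=
  exists x : X, x != 0.

(* Only meaningful for [nonzero_space X]: the zero space has an empty unit
   sphere, hence both properties for every [kappa]. *)
Definition Dau (R : realType) (X : completeNormedModType R) : Type :=
  least_cardinal (fun kappa => ~ daugavet kappa X).

Definition pDau (R : realType) (X : completeNormedModType R) : Type :=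
  least_cardinal (fun kappa => ~ perfect_daugavet kappa X).

(* [kappa] is the minimum of the cardinals [K i] over the indices in [J]. *)
Definition is_min_cardinal (I : Type) (J : set I) (K : I -> Type)
    (kappa : Type) : Prop :=
  (exists2 i, J i & [set: kappa] #= [set: K i]) /\
  forall i, J i -> [set: kappa] #<= [set: K i].

(* Main.v *)
(** A functional on the sum splits as [f x = \sum_i f_i (x i)], so points [x i]
  in slices of the [f_i] of small enough width form a point of the slice of [f].
  For the converse, a coordinate slice pulls back along the projection, and
  [X i] embeds isometrically: the other coordinates of [emb y + x] have norm at
  most 1, so if that vector has norm greater than 1, then its norm is attained
  at [i].  For a unit vector [y] of the sum, some coordinate [y i] has norm 1,
  and it is enough to make [y i + x i] long.

  The failing cardinals of the sum are those failing for some [X i].  Minima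
  then compare because the failing cardinals form a nonempty up-set and
  cardinals are well-ordered. *)

Require Import Defs.
From mathcomp Require Import all_boot all_order all_algebra.
From mathcomp Require Import boolp classical_sets functions cardinality reals.
From mathcomp Require Import topology normedtype.
From HB Require Import structures.

Set Implicit Arguments.
Unset Strict Implicit.
Unset Printing Implicit Defensive.

Import Order.TTheory GRing.Theory Num.Theory.
Import numFieldNormedType.Exports.

Local Open Scope classical_set_scope.
Local Open Scope card_scope.
Local Open Scope ring_scope.

(** * Comparison and minima of cardinals *)

Lemma inj_on_card_le T U (f : T -> U) (A : set T) (B : set U) :
  {in A &, injective f} -> (forall x, A x -> B (f x)) -> A #<= B.
Proof.
move=> finj fAB; rewrite -(card_le_eql (inj_card_eq finj)).
by apply: subset_card_le => _ [x Ax <-]; exact: fAB.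
Qed.

Lemma card_le_injective T U :
  [set: T] #<= [set: U] -> exists f : T -> U, injective f.
Proof.
move=> /card_leP[f].
exists (fun x => val (f (SigSub (mem_set (I : [set: T] x))))) => x y.
by move=> /val_inj /(@injT _ _ f) [].
Qed.

(* A maximal set of choice functions, no two of which agree at any index,
   projects onto some [A j]; it injects into every [A k]. *)
Lemma exists_min_card J T (A : J -> set T) (j0 : J) :
  exists j, forall k, A j #<= A k.
Proof.
pose P (M : set (J -> T)) := (forall g j, M g -> A j (g j)) /\
  (forall g h j, M g -> M h -> g j = h j -> g = h).
have [F FP Ftot|M [[MA Minj] Mmax]] := @Zorn_bigcup _ P.
  split=> [g j [B FB Bg]|g h j [B FB Bg] [C FC Ch]].
    by have [BA _] := FP _ FB; exact: BA.
  have [BC|CB] := Ftot _ _ FB FC.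
    by have [_ Cinj] := FP _ FC; apply: Cinj => //; exact: BC.
  by have [_ Binj] := FP _ FB; apply: Binj => //; exact: CB.
apply: contrapT => /forallNP noj.
(* If the values at [j] of members of [M] covered [A j], then [A j] would be at most [M] in
   cardinality, and evaluation at [k] injects [M] into every [A k]. *)
have new j : exists t, A j t /\ forall g, M g -> g j <> t.
  apply: contrapT => /forallNP not.
  apply: (noj j) => k; apply: (@card_le_trans _ _ _ M).
    have AM : A j `<=` (fun g : J -> T => g j) @` M.
      move=> t Ajt; apply: contrapT => /forall2NP Mt.
      apply: (not t); split=> // g Mg gt.
      by have [] := Mt g.
    exact: card_le_trans (subset_card_le AM) (card_image_le _ _).
  apply: (@inj_on_card_le _ _ (fun g => g k)) => [g h|g Mg]; last exact: MA.
  by move=> /set_mem Mg /set_mem Mh; exact: Minj.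
have [t tP] := choice new.
(* The function [t] differs from each member of [M] at every index, so adding it contradicts
   maximality; [j0] serves to see that [t] is outside [M]. *)
apply: (Mmax (M `|` [set t])); last first.
  split=> [g j [/MA//|->]|g h j]; first by case: (tP j).
  case=> [Mg|->] [Mh|->] //; first exact: Minj.
    by move=> gt; case: (tP j) => _ /(_ _ Mg).
  by move=> gt; case: (tP j) => _ /(_ _ Mh); rewrite gt.
split; first exact: subsetUl.
move=> MtM; have Mt : M t by apply: MtM; right.
by case: (tP j0) => _ /(_ _ Mt).
Qed.

Lemma card_le_total T U :
  [set: T] #<= [set: U] \/ [set: U] #<= [set: T].
Proof.
pose A (b : bool) : set (T + U) := if b then range inl else range inr.
have AT : A true #= [set: T] by apply: inj_card_eq => x y _ _ [].
have AU : A false #= [set: U] by apply: inj_card_eq => x y _ _ [].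
have [[] Ab] := exists_min_card A true.
- by left; rewrite -(card_le_eql AT) -(card_le_eqr AU).
- by right; rewrite -(card_le_eql AU) -(card_le_eqr AT).
Qed.

Definition card_upward (P : Type -> Prop) : Prop :=
  forall k l : Type, [set: k] #<= [set: l] -> P k -> P l.

(** [exists_min_card] compares subsets of one type, so the minimum is taken over subsets of [K]. Any
    other type either dominates [K] or is replaced by its range in [K]. *)
Lemma exists_least_cardinal (P : Type -> Prop) (K : Type) :
  card_upward P -> P K -> exists k, is_least_cardinal P k.
Proof.
move=> Pup PK.
pose J := {A : set K | P A}.
have PT : P [set: K] by apply: Pup PK; rewrite (card_le_eqr (card_setT _)).
have [[A PA] /= Amin] := exists_min_card (fun j : J => sval j) (exist _ _ PT).
exists A; split=> // L PL; rewrite (card_le_eql (card_setT A)).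
have [LK|KL] := card_le_total L K; last first.
  exact: card_le_trans (Amin (exist _ _ PT)) KL.
have [f finj] := card_le_injective LK.
have fL : range f #= [set: L] by apply: inj_card_eq => x y _ _ /finj.
have PfL : P (range f).
  by apply: Pup PL; rewrite (card_le_eqr (card_setT _)) (card_le_eqr fL).
by rewrite -(card_le_eqr fL); exact: (Amin (exist _ _ PfL)).
Qed.

Lemma least_cardinalP (P : Type -> Prop) (K : Type) :
  card_upward P -> P K -> is_least_cardinal P (least_cardinal P).
Proof.
move=> Pup PK; rewrite /least_cardinal; case: pselect => [ex|].
  exact: projT2 (cid ex).
by move=> /(_ (exists_least_cardinal Pup PK)).
Qed.

(** The least cardinal of [P] satisfies some [Q i], and that index attains the minimum. [J] keeps
    exactly the indices whose least cardinal is not junk. *)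
Lemma is_min_least_cardinal (I : Type) (J : set I) (P : Type -> Prop)
    (Q : I -> Type -> Prop) :
  (exists i, J i) ->
  (forall k, P k <-> exists i, Q i k) ->
  (forall i, card_upward (Q i)) ->
  (forall i, J i <-> exists k, Q i k) ->
  is_min_cardinal J (fun i => least_cardinal (Q i)) (least_cardinal P).
Proof.
move=> [i0 Ji0] PQ Qup QJ.
have Pup : card_upward P.
  by move=> k l kl /PQ[i Qik]; apply/PQ; exists i; exact: Qup Qik.
have [K PK] : exists K, P K.
  by have [k Qk] := (QJ i0).1 Ji0; exists k; apply/PQ; exists i0.
have [Pl Pmin] := least_cardinalP Pup PK.
have leJ i : J i -> [set: least_cardinal P] #<= [set: least_cardinal (Q i)].
  move=> /QJ[k Qk]; have [Ql _] := least_cardinalP (Qup i) Qk.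
  by apply: Pmin; apply/PQ; exists i.
split=> //; have [i Qi] := (PQ _).1 Pl.
have Ji : J i by apply/QJ; exists (least_cardinal P).
exists i => //; have [_ Qmin] := least_cardinalP (Qup i) Qi.
by rewrite card_eq_le (leJ _ Ji) Qmin.
Qed.

(** * Slices and the Daugavet property at a fixed threshold *)

Section slices.
Context (R : realType) (X : completeNormedModType R).
Local Notation B := (@unit_ball R X).

Lemma unit_ball0 : B 0.
Proof. by rewrite /unit_ball /= normr0. Qed.

Lemma has_sup_unit_ball (f : {linear X -> R^o}) :
  continuous f -> has_sup (f @` B).
Proof.
move=> fc; split; first by exists (f 0), 0 => //; exact: unit_ball0.
have /linear_bounded_continuous/linear_boundedP/pinfty_ex_gt0[r r0 fr] := fc.
exists r => _ [x xB <-]; apply: le_trans (ler_norm _) _.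
by apply: le_trans (fr x) _; rewrite ler_piMr// ltW.
Qed.

(** The zero functional has supremum 0 on the ball, so its open half-space of width 1 is
    everything. *)
Lemma is_slice_unit_ball : is_slice B.
Proof.
exists (\0 : {linear X -> R^o}), 1; split=> //; first exact: cst_continuous.
have -> : (\0 : {linear X -> R^o}) @` B = [set 0].
  apply/seteqP; split=> [_ [x _ <-]//|_ ->]; exists 0 => //; exact: unit_ball0.
by rewrite sup1; apply/seteqP; split=> x /=; rewrite sub0r ltrN10 // => -[].
Qed.

(* Both Daugavet properties are instances of this one: [c = 2] is the perfect
   property, and all [c < 2] together give the plain one. *)
Definition daugavet_at (c : R) (kappa : Type) : Prop :=
  forall Y : set X, Y `<=` @unit_sphere R X -> Y #<= [set: kappa] ->
  forall S : set X, is_slice S ->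
  exists2 x, S x & forall y, Y y -> c <= `|y + x|.

Lemma is_slice_sub (S : set X) : is_slice S -> S `<=` B.
Proof. by move=> [f [a [_ _ ->]]] x []. Qed.

(** A unit vector plus a vector of the ball has norm at most 2, so a lower bound of 2 is an
    equality. *)
Lemma perfect_daugavetP kappa :
  perfect_daugavet kappa X <-> daugavet_at 2 kappa.
Proof.
split=> D Y Y1 Yk S sS; have [x Sx xY] := D Y Y1 Yk S sS; exists x => // y Yy.
  by rewrite xY.
apply/le_anti; rewrite xY// andbT (le_trans (ler_normD _ _))//.
by rewrite (Y1 _ Yy) [leRHS]mulr2n lerD2l; exact: is_slice_sub Sx.
Qed.

Lemma daugavetP kappa :
  daugavet kappa X <-> forall c, 1 < c < 2 -> daugavet_at c kappa.
Proof.
split=> [D c /andP[_ c2] Y Y1 Yk S sS|D Y Y1 Yk S e sS e0].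
  have [|x Sx xY] := D Y Y1 Yk S (2 - c) sS; first by rewrite subr_gt0.
  by exists x => // y /xY; rewrite subKr => /ltW.
(* Less than [e] for the estimate, and less than 1 to keep [2 - d] above 1. *)
pose d := Num.min (e / 2) (1 / 2).
have de : d < e by rewrite gt_min ltr_pdivrMr// ltr_pMr// ltr1n.
have d0 : 0 < d by rewrite lt_min !divr_gt0.
have d1 : d < 1 by rewrite gt_min orbC ltr_pdivrMr// mul1r ltr1n.
have c12 : 1 < 2 - d < 2 by rewrite gtrBl d0 mulr2n ltrBrDl ltrD2r d1.
have [x Sx xY] := D _ c12 Y Y1 Yk S sS.
by exists x => // y /xY; apply: lt_le_trans; rewrite ltrD2l ltrN2.
Qed.

Lemma daugavet_at_card_le c kappa lambda :
  [set: kappa] #<= [set: lambda] -> daugavet_at c lambda -> daugavet_at c kappa.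
Proof. by move=> kl D Y Y1 Yk; apply: D => //; exact: card_le_trans Yk kl. Qed.

(* Test the unit ball against its whole sphere: [- x / |x|] is at distance
   [1 - |x|] from [- x]. *)
Lemma daugavet_at_carrier c : 1 < c -> nonzero_space X -> ~ daugavet_at c X.
Proof.
move=> c1 [u u0] D.
have [] := D (@unit_sphere R X) _ _ _ is_slice_unit_ball.
- by [].
- exact: card_leT.
move=> x x1 xS.
have normalize (v : X) : v != 0 -> unit_sphere (`|v|^-1 *: v).
  by move=> v0; rewrite /unit_sphere /= normrZ normfV normr_id mulVf// normr_eq0.
have [x0|x0] := eqVneq x 0.
  have := xS _ (normalize u u0).
  by rewrite x0 addr0 (normalize u u0) leNgt c1.
have /normalize : - x != 0 by rewrite oppr_eq0.
move=> /xS; rewrite normrN scalerN addrC -[X in X - _]scale1r -scalerBl normrZ.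
rewrite -{2}(normr_id x) -normrM mulrBl mul1r mulVf ?normr_eq0//.
rewrite distrC ger0_norm ?subr_ge0//; apply/negP; rewrite -ltNge.
by rewrite (le_lt_trans _ c1)// gerBl.
Qed.

(** The sphere is empty, so what remains is that a slice has a point, by approximation of the
    supremum. *)
Lemma daugavet_at_zero c kappa : ~ nonzero_space X -> daugavet_at c kappa.
Proof.
move=> X0 Y Y1 _ S [f [a [fc a0 ->]]].
have [_ [x Bx <-] xa] := sup_adherent a0 (has_sup_unit_ball fc).
exists x => // y /Y1 y1; exfalso; apply: X0; exists y.
by rewrite -normr_eq0 y1 oner_eq0.
Qed.

End slices.

(** * Passing between the sum and its coordinates *)

Section linf_sum_daugavet.
Context (R : realType) (I : finType) (X : I -> completeNormedModType R).
Local Notation E := (linf_sum X).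

Definition linf_emb (i : I) (u : X i) : E := dfwith (0 : E) u.
Definition linf_proj (i : I) (x : E) : X i := x i.

Lemma linf_embE i (u : X i) : linf_emb u i = u.
Proof. exact: dfwith_in. Qed.

Lemma linf_emb_out i j (u : X i) : i != j -> linf_emb u j = 0.
Proof. exact: dfwith_out. Qed.

Fact linf_emb_linear i : linear (@linf_emb i).
Proof.
move=> a u v; apply: functional_extensionality_dep => j.
change (linf_emb (a *: u + v) j = a *: linf_emb u j + linf_emb v j).
have [<-|ij] := eqVneq i j; first by rewrite !linf_embE.
by rewrite !linf_emb_out// scaler0 addr0.
Qed.

HB.instance Definition _ i :=
  GRing.isLinear.Build R (X i) E *:%R (@linf_emb i) (@linf_emb_linear i).

Fact linf_proj_linear i : linear (@linf_proj i).
Proof. by []. Qed.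

HB.instance Definition _ i :=
  GRing.isLinear.Build R E (X i) *:%R (@linf_proj i) (@linf_proj_linear i).

Lemma linf_norm_emb i (u : X i) : `|linf_emb u| = `|u|.
Proof.
apply/le_anti; rewrite -{3}(linf_embE u) (linf_norm_coord (linf_emb u)) andbT.
apply: (@linf_norm_le _ _ _ (linf_emb u)) => // j.
have [<-|ij] := eqVneq i j; first by rewrite linf_embE.
by rewrite linf_emb_out// normr0.
Qed.

Lemma linf_sum_emb (x : E) : x = \sum_i linf_emb (x i).
Proof.
apply: functional_extensionality_dep => j.
(* Evaluation at [j] is read as an additive map, so that it passes through the sum. *)
rewrite -[RHS]/(linf_proj j _) raddf_sum (bigD1 j)//= big1 ?addr0.
  by rewrite /linf_proj linf_embE.
by move=> i ij; rewrite /linf_proj linf_emb_out.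
Qed.

Lemma contraction_continuous (V W : normedModType R) (f : {linear V -> W}) :
  (forall x, `|f x| <= `|x|) -> continuous f.
Proof.
move=> f1; apply/linear_bounded_continuous/linear_boundedP.
near=> r => x; apply: le_trans (f1 x) _; rewrite ler_peMl//.
Unshelve. all: by end_near. Qed.

(** Positivity rules out the default value 0 of the maximum, which is the norm when [I] is empty. *)
Lemma linf_norm_attained (x : E) : 0 < `|x| -> exists i, `|x i| = `|x|.
Proof.
move=> x0; apply: contrapT => /forallNP xi.
suff : `|x| < `|x| by rewrite ltxx.
rewrite {1}linf_normE bigmax_lt// => i _.
by rewrite lt_neqAle (linf_norm_coord x) andbT; apply/eqP; exact: xi.
Qed.

Lemma daugavet_at_linf_coord c kappa i :
  1 < c -> daugavet_at E c kappa -> daugavet_at (X i) c kappa.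
Proof.
move=> c1 D Y Y1 Yk S [f [a [fc a0 SE]]].
pose g : {linear E -> R^o} := f \o @linf_proj i.
have gc : continuous g.
  move=> x; apply: continuous_comp; last exact: fc.
  by apply: contraction_continuous => {}x; exact: linf_norm_coord.
(* The projection maps ball onto ball, so both slices are cut at the same level. *)
have gB : g @` @unit_ball R E = f @` @unit_ball R (X i).
  apply/seteqP; split=> _ [x x1 <-].
    by exists (x i) => //; exact: le_trans (linf_norm_coord x i) x1.
  exists (linf_emb x); first by rewrite /unit_ball /= linf_norm_emb.
  by rewrite /g /= /linf_proj linf_embE.
have [|||x [x1 xa] xY] := D (@linf_emb i @` Y) _ _
    [set x | unit_ball x /\ sup (g @` @unit_ball R E) - a < g x].
- by move=> _ [y /Y1 y1 <-]; rewrite /unit_sphere /= linf_norm_emb.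
- exact: card_le_trans (card_image_le _ _) Yk.
- by exists g, a.
have xi1 j : `|x j| <= 1 := le_trans (linf_norm_coord x j) x1.
exists (x i) => [|y Yy]; first by rewrite SE; split; [exact: xi1|rewrite -gB].
(* Were coordinate [i] shorter than [c], all coordinates would be, and so would their maximum. *)
rewrite leNgt; apply/negP => yxc.
suff : `|linf_emb y + x| < c.
  by rewrite ltNge => /negP; apply; apply: xY; exists y.
rewrite linf_normE bigmax_lt//; first exact: lt_trans c1.
move=> j _; rewrite -[X in `|X|]/(linf_emb y j + x j).
have [<-|ij] := eqVneq i j; first by rewrite linf_embE.
by rewrite linf_emb_out// add0r (le_lt_trans _ c1).
Qed.

Lemma daugavet_at_linf_sum c kappa :
  (forall i, daugavet_at (X i) c kappa) -> daugavet_at E c kappa.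
Proof.
move=> D Y Y1 Yk S [f [a [fc a0 ->]]].
pose g i : {linear X i -> R^o} := f \o @linf_emb i.
have gc i : continuous (g i).
  move=> x; apply: continuous_comp; last exact: fc.
  by apply: contraction_continuous => {}x; rewrite linf_norm_emb.
have fE x : f x = \sum_i g i (x i).
  by rewrite {1}(linf_sum_emb x) raddf_sum.
pose s i := sup (g i @` @unit_ball R (X i)).
(* The [#|I|] losses of [b] add up to strictly less than [a]; the successor also covers an empty
   [I]. *)
pose b := a / #|I|.+1%:R.
have b0 : 0 < b by rewrite divr_gt0.
(* Coordinate [i] handles only those [y] with [y i] on the unit sphere; each [y] in [Y] is handled
   by a coordinate attaining its norm. *)
have xP i : exists u : X i, [/\ `|u| <= 1, s i - b < g i u &
    forall y, Y y -> `|y i| = 1 -> c <= `|y i + u|].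
  have [|||u [u1 ub] uY] := D i (@linf_proj i @` Y `&` @unit_sphere R (X i)) _ _
      [set u | unit_ball u /\ s i - b < g i u].
  - by move=> u [].
  - apply: card_le_trans Yk; apply: card_le_trans (card_image_le (@linf_proj i) Y).
    exact: subset_card_le (@subIsetl _ _ _).
  - by exists (g i), b.
  exists u; split=> // y Yy y1; apply: uY; split=> //.
  by exists y.
pose x : E := fun i => sval (cid (xP i)).
have xQ i : [/\ `|x i| <= 1, s i - b < g i (x i) &
    forall y, Y y -> `|y i| = 1 -> c <= `|y i + x i|].
  exact: svalP (cid (xP i)).
exists x; last first.
  move=> y Yy; have y1 := Y1 y Yy.
  have [|i] := @linf_norm_attained y; first by rewrite y1.
  rewrite y1 => yi; have [_ _ /(_ _ Yy yi) cyx] := xQ i.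
  exact: le_trans cyx (linf_norm_coord (y + x) i).
split; first by apply: (@linf_norm_le _ _ _ x) => // i; case: (xQ i).
have supf : sup (f @` @unit_ball R E) <= \sum_i s i.
  apply: ge_sup; first exact: (has_sup_unit_ball fc).1.
  move=> _ [z z1 <-]; rewrite fE; apply: ler_sum => i _.
  apply: sup_upper_bound; first exact: has_sup_unit_ball.
  by exists (z i) => //; exact: le_trans (linf_norm_coord z i) z1.
have Ib : \sum_(i : I) b < a.
  rewrite sumr_const -mulr_natr mulrAC ltr_pdivrMr// ltr_pM2l//.
  by rewrite ltr_nat.
apply: (@lt_le_trans _ _ (\sum_i (s i - b))).
  by rewrite sumrB; apply: ler_ltB.
by rewrite fE; apply: ler_sum => i _; case: (xQ i) => _ /ltW.
Qed.

Lemma perfect_daugavet_linf_sum kappa :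
  perfect_daugavet kappa E <-> forall i, perfect_daugavet kappa (X i).
Proof.
split=> [/perfect_daugavetP D i|D]; apply/perfect_daugavetP.
  by apply: daugavet_at_linf_coord D; rewrite ltr1n.
by apply: daugavet_at_linf_sum => i; apply/perfect_daugavetP.
Qed.

Lemma daugavet_linf_sum kappa :
  daugavet kappa E <-> forall i, daugavet kappa (X i).
Proof.
split=> [/daugavetP D i|D]; apply/daugavetP => c c12.
  by apply: daugavet_at_linf_coord (D c c12); case/andP: c12.
by apply: daugavet_at_linf_sum => i; have /daugavetP := D i; exact.
Qed.

End linf_sum_daugavet.

(** * Cardinals for which the properties fail *)

Section cardinals.
Context (R : realType) (X : completeNormedModType R).

Lemma not_daugavet_upward : card_upward (fun k => ~ daugavet k X).
Proof.
move=> k l kl nD /daugavetP D; apply: nD; apply/daugavetP => c c12.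
exact: daugavet_at_card_le kl (D c c12).
Qed.

Lemma not_perfect_daugavet_upward : card_upward (fun k => ~ perfect_daugavet k X).
Proof.
move=> k l kl nD /perfect_daugavetP D; apply: nD; apply/perfect_daugavetP.
exact: daugavet_at_card_le kl D.
Qed.

(** The carrier of a nonzero space is large enough to index its whole sphere, where any threshold in
    [(1, 2)] fails, such as [3 / 2]. *)
Lemma nonzero_not_daugavet : nonzero_space X <-> exists k, ~ daugavet k X.
Proof.
split=> [X0|[k nD]].
  exists X => /daugavetP/(_ (3 / 2)) D.
  have c1 : 1 < 3 / 2 :> R by rewrite ltr_pdivlMr// mul1r ltr_nat.
  apply: (daugavet_at_carrier c1 X0); apply: D.
  by rewrite c1 ltr_pdivrMr// -natrM ltr_nat.
apply: contrapT => X0; apply: nD; apply/daugavetP => c _.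
exact: daugavet_at_zero.
Qed.

Lemma nonzero_not_perfect_daugavet :
  nonzero_space X <-> exists k, ~ perfect_daugavet k X.
Proof.
split=> [X0|[k nD]].
  by exists X => /perfect_daugavetP; apply: daugavet_at_carrier => //; rewrite ltr1n.
apply: contrapT => X0; apply: nD; apply/perfect_daugavetP.
exact: daugavet_at_zero.
Qed.

End cardinals.

Theorem proposition6p3 (R : realType) (I : finType)
    (X : I -> completeNormedModType R) :
  (forall kappa : Type,
     (daugavet kappa (linf_sum X) <-> forall i, daugavet kappa (X i)) /\
     (perfect_daugavet kappa (linf_sum X) <->
        forall i, perfect_daugavet kappa (X i))) /\
  ((exists i, nonzero_space (X i)) ->
     is_min_cardinal [set i | nonzero_space (X i)] (fun i => Dau (X i))
       (Dau (linf_sum X)) /\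
     is_min_cardinal [set i | nonzero_space (X i)] (fun i => pDau (X i))
       (pDau (linf_sum X))).
Proof.
split=> [kappa|X0].
  by split; [exact: daugavet_linf_sum|exact: perfect_daugavet_linf_sum].
split; apply: is_min_least_cardinal => //.
- by move=> k; rewrite daugavet_linf_sum existsNP.
- by move=> i; exact: not_daugavet_upward.
- by move=> i; exact: nonzero_not_daugavet.
- by move=> k; rewrite perfect_daugavet_linf_sum existsNP.
- by move=> i; exact: not_perfect_daugavet_upward.
- by move=> i; exact: nonzero_not_perfect_daugavet.
Qed.
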